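(* Let $d\le N$ be positive integers and let $X, X'\in \mathbb{Z}^{d\times N}$ be matrices of rank $d$ that represent the same arithmetic matroid $\mathcal{A}=(E,\operatorname{rk},m)$ on $E=[N]$, and suppose that $\mathcal{A}$ is weakly multiplicative. Then there exist a matrix $T\in \mathrm{GL}(d,\mathbb{Z})$ and a diagonal matrix $D\in\mathbb{Z}^{N\times N}$ with diagonal entries in $\{1,-1\}$ such that $X' = T X D$.
   Context: For $X\in\mathbb{Z}^{d\times N}$ with columns $x_1,\dots,x_N$, the arithmetic matroid $\mathcal{A}(X)=([N],\operatorname{rk},m)$ represented by $X$ consists of the rank function $\operatorname{rk}(S)=\dim \langle x_e : e\in S\rangle_{\mathbb{R}}$ and the multiplicity function $m(S)=\bigl|(\langle S\rangle_{\mathbb{R}}\cap\mathbb{Z}^d)/\langle S\rangle\bigr|$ for $S\subseteq[N]$, where $\langle S\rangle\subseteq\mathbb{Z}^d$ is the subgroup generated by $\{x_e: e\in S\}$ and $\langle S\rangle_{\mathbb{R}}$ is the real span of the same vectors. Two matrices represent the same arithmetic matroid if their rank functions and multiplicity functions on subsets of $[N]$ coincide. A basis of $\mathcal{A}$ is a basis of the underlying matroid $([N],\operatorname{rk})$. The arithmetic matroid is torsion-free if $m(\emptyset)=1$ (automatic here). A basis $B$ is multiplicative if $m(B)=\prod_{x\in B} m(\{x\})$; a torsion-free arithmetic matroid is weakly multiplicative if it has at least one multiplicative basis. *)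

(* Defs.v *)
From HB Require Import structures.
From mathcomp Require Import all_boot all_order all_algebra.
From mathcomp Require Import Rstruct.
From Stdlib Require Import Rdefinitions.
Set Implicit Arguments. Unset Strict Implicit. Unset Printing Implicit Defensive.
Import Order.TTheory GRing.Theory Num.Theory.
Local Open Scope ring_scope.

Notation RR := Rdefinitions.R.

Definition intR (z : int) : RR := z%:~R.

Section ArithMatroid.
Variables (d N : nat).
Implicit Types (X : 'M[int]_(d, N)) (S : {set 'I_N}).

(* The matrix whose rows are the real vectors x_e (e in S), and 0 for e not in S:
   its row space is the real span <S>_R of {x_e : e in S}. *)
Definition colsR X S : 'M[RR]_(N, d) :=
  \matrix_(i < N, j < d) if i \in S then intR (X j i) else 0.

Definition arank X S : nat := \rank (colsR X S).

Definition in_lattice X S (v : 'cV[int]_d) : Prop :=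
  exists c : 'I_N -> int, v = \sum_(e in S) c e *: col e X.

Definition in_saturation X S (v : 'cV[int]_d) : Prop :=
  (map_mx intR v^T <= colsR X S)%MS.

(* mult X S k  <->  |(<S>_R ∩ Z^d) / <S>| = k :
   there is a complete, irredundant system of k coset representatives. *)
Definition mult X S (k : nat) : Prop :=
  exists reps : 'I_k -> 'cV[int]_d,
    [/\ forall i, in_saturation X S (reps i),
        forall i j, in_lattice X S (reps i - reps j) -> i = j
      & forall v, in_saturation X S v -> exists i, in_lattice X S (v - reps i)].

Definition same_arith_matroid X X' : Prop :=
  forall S, arank X S = arank X' S /\ (forall k, mult X S k <-> mult X' S k).

Definition is_basis X S : Prop :=
  arank X S = #|S| /\ arank X S = arank X [set: 'I_N].

Definition multiplicative_basis X S : Prop :=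
  exists (mB : nat) (mx : 'I_N -> nat),
    [/\ mult X S mB, forall x, x \in S -> mult X [set x] (mx x)
      & mB = (\prod_(x in S) mx x)%N].

Definition weakly_multiplicative X : Prop :=
  exists B, is_basis X B /\ multiplicative_basis X B.

End ArithMatroid.

(* Main.v *)
Require Import Defs.
From HB Require Import structures.
From mathcomp Require Import all_boot all_order all_algebra.
From mathcomp Require Import Rstruct.
Set Implicit Arguments.
Unset Strict Implicit.
Unset Printing Implicit Defensive.
Import Order.TTheory GRing.Theory Num.Theory.
Local Open Scope ring_scope.

(** The multiplicity of a basis is the absolute value of its determinant, and
    the multiplicity of an element divides all the entries of its column.  For
    a multiplicative basis [B] this gives [X_B = P diag(k)] and
    [X'_B = P' diag(k)] with [P], [P'] unimodular and the same [k], so that one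
    may assume [X_B = X'_B = diag(k)], while all maximal minors of [X] and [X']
    agree up to sign.  Signs are then matched one column at a time.  Let [W] be
    the columns already equal, among them the diagonal ones, and let [a], [a']
    be the next columns.  Replacing a column of a square submatrix of [W] by
    [a - a'] and by [a + a'] gives determinants whose product is a difference
    of equal squares, hence zero.  Link two rows when some column of [W] is
    nonzero in both.  Then no path of links joins the supports of [a - a'] and
    [a + a']: pivoting would shorten it until a single row lies in both.  So
    flipping the rows of some connected components, and the columns supported
    on them, turns [a] into [a'] and preserves [W]. *)

Section SetColumn.
Variables (R : comPzRingType) (d : nat).
Implicit Types (M : 'M[R]_d) (m : 'I_d) (w : 'cV[R]_d).

Definition set_col M m w : 'M[R]_d :=
  \matrix_(i, l) if l == m then w i 0 else M i l.

Lemma det_set_col M m w : \det (set_col M m w) = (\adj M *m w) m 0.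
Proof.
rewrite (expand_det_col _ m) mxE; apply: eq_bigr => i _.
rewrite !mxE eqxx mulrC; congr (_ * \det _ * _).
by apply/matrixP => a b; rewrite !mxE eq_sym (negbTE (neq_lift _ _)).
Qed.

Lemma mulmx_set_col P M m w :
  P *m set_col M m w = set_col (P *m M) m (P *m w).
Proof.
apply/matrixP => i l; rewrite !mxE.
by case: (eqVneq l m) => [->|/negbTE ne_lm]; rewrite ?mxE;
  apply: eq_bigr => j _; rewrite mxE ?eqxx ?ne_lm.
Qed.

Lemma set_col_colsub n (W : 'M[R]_(d, n)) (g : 'I_d -> 'I_n) m w :
  set_col (colsub g W) m w =
  colsub (fun l => if l == m then lshift n 0 else rshift 1 (g l)) (row_mx w W).
Proof.
apply/matrixP => i l; rewrite [LHS]mxE [RHS]mxE.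
by case: (l == m); rewrite ?row_mxEl ?row_mxEr ?mxE.
Qed.

End SetColumn.

Section Pivoting.
Variables (R : comPzRingType) (d n : nat).
Implicit Types (W : 'M[R]_(d, n)) (u v : 'cV[R]_d).

Definition adjacent W : rel 'I_d :=
  fun i k => [exists j, (W i j != 0) && (W k j != 0)].

Definition axis_columns W :=
  forall l, exists2 j, W l j != 0 & forall i, i != l -> W i j = 0.

(* No hyperplane spanned by columns of [W] avoids both [u] and [v]. *)
Definition complementary_minors W u v := forall (g : 'I_d -> 'I_n) m,
  \det (set_col (colsub g W) m u) * \det (set_col (colsub g W) m v) = 0.

Lemma complementary_minors_mulmx P W u v :
  complementary_minors W u v ->
  complementary_minors (P *m W) (P *m u) (P *m v).
Proof.
move=> minors0 g m; rewrite -mulmx_colsub -!mulmx_set_col !det_mulmx.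
by rewrite mulrACA minors0 mulr0.
Qed.

(* Fraction-free Gaussian pivoting: column [c] of [W] is cleared outside row
   [r], at the cost of scaling every row by [W r c]. *)
Definition pivot_mx W (r : 'I_d) (c : 'I_n) : 'M[R]_d :=
  (W r c)%:M - (col c W - W r c *: delta_mx r 0) *m delta_mx 0 r.

Lemma pivot_mxE p (B : 'M[R]_(d, p)) W r c i j :
  (pivot_mx W r c *m B) i j =
  W r c * B i j - (W i c - W r c *+ (i == r)) * B r j.
Proof.
rewrite mulmxBl -mulmxA -rowE mul_scalar_mx !mxE big_ord1 !mxE eqxx andbT.
by rewrite mulr_natr.
Qed.

Lemma pivot_mx_scale p (B : 'M[R]_(d, p)) W r c i j :
  B r j = 0 -> (pivot_mx W r c *m B) i j = W r c * B i j.
Proof. by move=> B0; rewrite pivot_mxE B0 mulr0 subr0. Qed.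

End Pivoting.

Section Disconnection.
Variables (R : idomainType) (d n : nat).
Implicit Types (W : 'M[R]_(d, n)) (u v : 'cV[R]_d).

Lemma complementary_minors_entries W u v i :
  axis_columns W -> complementary_minors W u v -> (u i 0 == 0) || (v i 0 == 0).
Proof.
move=> /fin_all_exists2[g nzW W0] /(_ g i).
pose A := colsub g W; pose k : 'rV_d := \row_l W l (g l).
have AE : A = diag_mx k.
  apply/matrixP => a b; rewrite !mxE.
  by have [->|/W0] := eqVneq a b.
have detA : \det A != 0.
  by rewrite AE det_diag; apply/prodf_neq0 => l _; rewrite mxE.
have detE (w : 'cV_d) : W i (g i) * \det (set_col A i w) = \det A * w i 0.
  have : (A *m \adj A *m w) i 0 = \det A * w i 0.
    by rewrite mul_mx_adj mul_scalar_mx mxE.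
  by rewrite -mulmxA {1}AE mul_diag_mx det_set_col !mxE.
move/(congr1 ( *%R (W i (g i) ^+ 2))); rewrite mulr0 expr2 mulrACA !detE.
by move/eqP; rewrite !mulf_eq0 (negbTE detA).
Qed.

Lemma axis_columns_pivot W r c :
  W r c != 0 -> axis_columns W -> axis_columns (pivot_mx W r c *m W).
Proof.
move=> nzW axesW l; have [->|ne_lr] := eqVneq l r.
  exists c => [|i /negbTE ne_ir]; rewrite pivot_mxE.
    by rewrite eqxx subrr mul0r subr0 mulf_neq0.
  by rewrite ne_ir subr0 mulrC subrr.
have [j nzWj Wj0] := axesW l; have Wrj : W r j = 0 by rewrite Wj0 // eq_sym.
exists j => [|i ne_il]; rewrite pivot_mx_scale ?mulf_neq0 //.
by rewrite Wj0 ?mulr0.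
Qed.

Lemma path_pivot W r c k p :
  W r c != 0 ->
  (forall q, (size q <= size p)%N -> path (adjacent W) r q ->
     last r q != last k p) ->
  path (adjacent W) k p -> path (adjacent (pivot_mx W r c *m W)) k p.
Proof.
move=> nzW; elim: p k => //= l p IHp k far.
case/andP=> /existsP[j /andP[Wkj Wlj]] pth.
apply/andP; split; last by apply: IHp => // q le_q; apply/far/leqW.
have Wrj : W r j = 0.
  apply/eqP; apply: contraT => Wrj; have /= := far (l :: p) (leqnn _).
  rewrite eqxx pth andbT; apply; apply/existsP; exists j; exact/andP.
by apply/existsP; exists j; rewrite !pivot_mx_scale // !mulf_neq0.
Qed.

(* Pivoting on a column that links [i] to the next row [k] of a shortest path
   moves the support of [u] to [k], and changes neither [v] nor the columns
   used by the rest of the path. *)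
Lemma complementary_minors_path_eq0 W u v i p :
  axis_columns W -> complementary_minors W u v ->
  path (adjacent W) i p -> u i 0 != 0 -> v (last i p) 0 = 0.
Proof.
have [N] := ubnP (size p); elim: N => // N IHN in W u v i p *.
case: p => [|k p] /= lt_pN axesW minors0.
  have := complementary_minors_entries i axesW minors0.
  by case/orP=> [->|/eqP].
case/andP=> /existsP[c /andP[Wic Wkc]] pth ui.
have near q : (size q <= size p)%N -> path (adjacent W) i q ->
    v (last i q) 0 = 0.
  move=> le_q pth_q; apply: IHN pth_q ui => //.
  exact: leq_ltn_trans le_q lt_pN.
apply/eqP; apply: contraT => vk.
have uk : u k 0 = 0.
  apply/eqP; apply: contraNT vk => uk.
  by rewrite (IHN _ _ _ _ _ _ _ minors0 pth).
have ne_ki : k != i by apply: contraNneq ui => <-; rewrite uk.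
pose P := pivot_mx W i c.
have pthP : path (adjacent (P *m W)) k p.
  apply: path_pivot => // q le_q pth_q.
  by apply: contraNneq vk => <-; rewrite near.
have Puk : (P *m u) k 0 != 0.
  by rewrite pivot_mxE uk (negbTE ne_ki) subr0 mulr0 sub0r oppr_eq0 mulf_neq0.
have := IHN _ _ _ _ _ lt_pN (axis_columns_pivot Wic axesW)
  (complementary_minors_mulmx P minors0) pthP Puk.
rewrite pivot_mx_scale; last exact: (near [::]).
by move/eqP; rewrite mulf_eq0 (negbTE Wic) (negbTE vk).
Qed.

End Disconnection.

Lemma mul_row_diag_mx (R : pzSemiRingType) m n p (A : 'M[R]_(p, m))
    (B : 'M[R]_(p, n)) (r : 'rV_m) (s : 'rV_n) :
  row_mx A B *m diag_mx (row_mx r s) =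
  row_mx (A *m diag_mx r) (B *m diag_mx s).
Proof. by rewrite diag_mx_row mul_row_block !mulmx0 addr0 add0r. Qed.

Section SignRows.
Variables (R : comPzRingType) (d : nat).

Definition sign_row n (r : 'rV[R]_n) := forall i, r 0 i ^+ 2 = 1.

Definition same_sqr_minors n (Y Y' : 'M[R]_(d, n)) :=
  forall g : 'I_d -> 'I_n, \det (colsub g Y) ^+ 2 = \det (colsub g Y') ^+ 2.

Lemma sign_row1 n : sign_row (const_mx 1 : 'rV_n).
Proof. by move=> i; rewrite mxE expr1n. Qed.

Lemma sign_rowM n (r s : 'rV[R]_n) :
  sign_row r -> sign_row s -> sign_row (\row_i (r 0 i * s 0 i)).
Proof. by move=> rs ss i; rewrite mxE exprMn rs ss mulr1. Qed.

Lemma sign_row_mx m n (r : 'rV[R]_m) (s : 'rV[R]_n) :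
  sign_row r -> sign_row s -> sign_row (row_mx r s).
Proof. by move=> rs ss i; rewrite mxE; case: split. Qed.

Lemma det_sign_row n (r : 'rV[R]_n) : sign_row r -> \det (diag_mx r) ^+ 2 = 1.
Proof. by move=> rs; rewrite det_diag -prodrXl big1. Qed.

Lemma sign_row_if n (P : pred 'I_n) :
  sign_row (\row_i if P i then -1 else 1).
Proof. by move=> i; rewrite mxE; case: (P i); rewrite ?sqrrN expr1n. Qed.

Lemma same_sqr_minors_colsub m n (h : 'I_m -> 'I_n) (Y Y' : 'M[R]_(d, n)) :
  same_sqr_minors Y Y' -> same_sqr_minors (colsub h Y) (colsub h Y').
Proof. by move=> minE g; rewrite -!colsub_comp. Qed.

Lemma same_sqr_minors_sign n (r : 'rV[R]_d) (c : 'rV[R]_n) Y Y' :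
  sign_row r -> sign_row c -> same_sqr_minors Y Y' ->
  same_sqr_minors (diag_mx r *m Y *m diag_mx c) Y'.
Proof.
move=> rs cs minE g; rewrite -minE.
have -> : colsub g (diag_mx r *m Y *m diag_mx c) =
    diag_mx r *m colsub g Y *m diag_mx (colsub g c).
  by rewrite mulmx_colsub; apply/matrixP => i l; rewrite !mul_mx_diag !mxE.
rewrite !det_mulmx !exprMn !det_sign_row ?mulr1 ?mul1r // => l.
by rewrite mxE.
Qed.

Lemma same_sqr_minors_complementary n (W : 'M[R]_(d, n)) (a a' : 'cV[R]_d) :
  same_sqr_minors (row_mx a W) (row_mx a' W) ->
  complementary_minors W (a - a') (a + a').
Proof.
move=> minE g m; pose S := colsub g W.
have sqrE : (\adj S *m a) m 0 ^+ 2 = (\adj S *m a') m 0 ^+ 2.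
  by rewrite -!det_set_col !set_col_colsub minE.
rewrite !det_set_col mulmxBr mulmxDr.
move: (\adj _ *m a) (\adj _ *m a') sqrE => b b' sqrE.
by rewrite !mxE -subr_sqr sqrE subrr.
Qed.

End SignRows.

Section SignEquivalence.
Variables (R : idomainType) (d : nat).

Definition sign_equiv n (A A' : 'M[R]_(d, n)) := exists r c,
  [/\ sign_row r, sign_row c & A' = diag_mx r *m A *m diag_mx c].

(* The flipped rows are those linked to a row in which [a] and [a'] differ. *)
Lemma sign_flip_column n (W : 'M[R]_(d, n)) (a a' : 'cV[R]_d) :
  axis_columns W -> same_sqr_minors (row_mx a W) (row_mx a' W) ->
  exists r c, [/\ sign_row r, sign_row c, a' = diag_mx r *m a
                & W = diag_mx r *m W *m diag_mx c].
Proof.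
move=> axesW /same_sqr_minors_complementary minors0.
pose K i := [exists k, connect (adjacent W) k i && (a k 0 != a' k 0)].
have Kadj i k j : K i -> W i j != 0 -> W k j != 0 -> K k.
  move=> /existsP[l /andP[li al]] Wij Wkj; apply/existsP; exists l.
  rewrite al andbT (connect_trans li) // connect1 //.
  by apply/existsP; exists j; rewrite Wij.
exists (\row_i if K i then -1 else 1).
exists (\row_j if [exists i, K i && (W i j != 0)] then -1 else 1).
split; try exact: sign_row_if.
  apply/colP => i; rewrite mul_diag_mx !mxE; case: ifP => [/existsP|/existsPn].
    case=> k /andP[/connectP[p pth ->] ne_aa'].
    have := complementary_minors_path_eq0 axesW minors0 pth.
    rewrite !mxE subr_eq0 mulN1r => /(_ ne_aa') /eqP.
    by rewrite addrC addr_eq0 => /eqP.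
  by move=> /(_ i); rewrite connect0 negbK mul1r => /eqP.
apply/matrixP => i j; rewrite mul_mx_diag mul_diag_mx !mxE.
have [->|Wij] := eqVneq (W i j) 0; first by rewrite mulr0 mul0r.
rewrite (_ : [exists k, _] = K i).
  by case: (K i); rewrite ?mulrN1 ?mulN1r ?opprK ?mulr1 ?mul1r.
apply/existsP/idP => [[k /andP[Kk Wkj]]|Ki]; first exact: Kadj Kk Wkj Wij.
by exists i; rewrite Ki.
Qed.

Lemma sign_equiv_row_mx n (B B' : 'M[R]_(d, n)) (a a' : 'cV[R]_d)
    (k : 'rV[R]_d) :
  (forall l, k 0 l != 0) -> sign_equiv B B' ->
  same_sqr_minors (row_mx a (row_mx B (diag_mx k)))
                  (row_mx a' (row_mx B' (diag_mx k))) ->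
  sign_equiv (row_mx a B) (row_mx a' B').
Proof.
move=> nzk [r [c [rs cs EB']]] minE; pose W := row_mx B' (diag_mx k).
have axesW : axis_columns W.
  move=> l; exists (rshift n l); first by rewrite row_mxEr mxE eqxx nzk.
  by move=> i ne_il; rewrite row_mxEr mxE (negbTE ne_il).
have rkr : diag_mx r *m diag_mx k *m diag_mx r = diag_mx k.
  rewrite (diag_mxC r) -mulmxA mulmx_diag mul_diag_mx.
  by apply/matrixP => i j; rewrite !mxE -expr2 rs mulrnAr mulr1.
have minEW : same_sqr_minors (row_mx (diag_mx r *m a) W) (row_mx a' W).
  have crs := sign_row_mx (@sign_row1 R 1) (sign_row_mx cs rs).
  have := same_sqr_minors_sign rs crs minE.
  by rewrite !(mul_mx_row, mul_row_diag_mx) rkr -EB' diag_const_mx mulmx1.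
have [r' [c' [rs' cs' Ea']]] := sign_flip_column axesW minEW.
rewrite -[c']hsubmxK mul_mx_row mul_row_diag_mx => /eq_row_mx[EB'' _].
exists (\row_i (r' 0 i * r 0 i)).
exists (row_mx (const_mx 1) (\row_j (c 0 j * lsubmx c' 0 j))).
split; first exact: sign_rowM.
  by apply/(sign_row_mx (@sign_row1 R 1))/sign_rowM => // i; rewrite mxE cs'.
rewrite mul_mx_row mul_row_diag_mx diag_const_mx mulmx1 -!mulmx_diag.
by congr row_mx; [rewrite -mulmxA | rewrite [LHS]EB'' EB' !mulmxA].
Qed.

Lemma sign_equiv_of_same_sqr_minors n (A A' : 'M[R]_(d, n)) (k : 'rV[R]_d) :
  (forall l, k 0 l != 0) ->
  same_sqr_minors (row_mx A (diag_mx k)) (row_mx A' (diag_mx k)) ->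
  sign_equiv A A'.
Proof.
move=> nzk; elim: n A A' => [|n IHn] A A'.
  move=> _; exists (const_mx 1), (const_mx 1); split; try exact: sign_row1.
  by rewrite [LHS]thinmx0 [RHS]thinmx0.
have row_mxP (Z : 'M[R]_(d, 1 + n)) : exists a B, Z = row_mx a B.
  by exists (lsubmx Z), (rsubmx Z); rewrite hsubmxK.
have [[a [B ->]] [a' [B' ->]]] := (row_mxP A, row_mxP A') => minE.
have {}minE : same_sqr_minors (row_mx a (row_mx B (diag_mx k)))
                              (row_mx a' (row_mx B' (diag_mx k))).
  by rewrite !row_mxA !castmx_id.
apply: (sign_equiv_row_mx nzk _ minE); apply: IHn.
have := same_sqr_minors_colsub (@rshift 1 (n + d)) minE.
by rewrite -!rsubmxEsub !row_mxKr.
Qed.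

Lemma unimodular_sign_equiv n (X X' : 'M[R]_(d, n)) (f : 'I_d -> 'I_n)
    (P P' : 'M[R]_d) (k : 'rV[R]_d) :
  P \in unitmx -> P' \in unitmx -> \det (colsub f X) != 0 ->
  colsub f X = P *m diag_mx k -> colsub f X' = P' *m diag_mx k ->
  same_sqr_minors X X' ->
  exists T c, [/\ T \in unitmx, sign_row c & X' = T *m X *m diag_mx c].
Proof.
move=> unitP unitP' nzdet EX EX' minE.
have nzk l : k 0 l != 0.
  move: nzdet; rewrite EX det_mulmx det_diag mulf_eq0 negb_or => /andP[_].
  by move/prodf_neq0; apply.
pose Y := invmx P *m X; pose Y' := invmx P' *m X'.
have EY : colsub f Y = diag_mx k by rewrite -mulmx_colsub EX mulKmx.
have EY' : colsub f Y' = diag_mx k by rewrite -mulmx_colsub EX' mulKmx.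
have sqr_detP : \det P ^+ 2 = \det P' ^+ 2.
  have := minE f; rewrite EX EX' !det_mulmx !exprMn => /mulIf; apply.
  by rewrite sqrf_eq0 det_diag; apply/prodf_neq0.
have minEY : same_sqr_minors Y Y'.
  move=> g; rewrite -!mulmx_colsub !det_mulmx !exprMn !det_inv minE.
  by rewrite !exprVn sqr_detP.
have minEYD : same_sqr_minors (row_mx Y (diag_mx k)) (row_mx Y' (diag_mx k)).
  pose h j := match split j with inl i => i | inr l => f l end.
  have rowE (Z : 'M[R]_(d, n)) : row_mx Z (colsub f Z) = colsub h Z.
    by apply/matrixP => i j; rewrite !mxE /h; case: split => l; rewrite ?mxE.
  by rewrite -{1}EY -EY' !rowE; apply: same_sqr_minors_colsub.
have [r [c [rs cs E]]] := sign_equiv_of_same_sqr_minors nzk minEYD.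
exists (P' *m diag_mx r *m invmx P), c; split=> //.
  rewrite !unitmx_mul unitP' unitmx_inv unitP andbT unitmxE.
  by rewrite -(unitrX_pos _ (ltn0Sn 1)) det_sign_row ?unitr1.
by rewrite -!mulmxA -[LHS](mulKVmx unitP') -/Y' E !mulmxA.
Qed.

End SignEquivalence.

HB.instance Definition _ := GRing.RMorphism.copy intR (intmul (1 : RR)).

Lemma map_intR_inj m n : injective (map_mx intR : 'M_(m, n) -> 'M_(m, n)).
Proof.
move=> A B /matrixP eqAB; apply/matrixP => i j.
by have := eqAB i j; rewrite !mxE => /intr_inj.
Qed.

Lemma map_intR_unit n (A : 'M[int]_n) :
  (map_mx intR A \in unitmx) = (\det A != 0).
Proof. by rewrite unitmxE det_map_mx unitfE intr_eq0. Qed.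

Lemma absz_prod (I : Type) (s : seq I) (P : pred I) (F : I -> int) :
  `|(\prod_(i <- s | P i) F i)%R|%N = (\prod_(i <- s | P i) absz (F i))%N.
Proof. exact: (big_morph absz abszM). Qed.

Lemma unitmx_absz_det n (P : 'M[int]_n) :
  (P \in unitmx) = (`|\det P|%N == 1%N).
Proof. by rewrite unitmxE; case: (\det P) => [[|[|m]]|[|m]]. Qed.

Lemma Smith_pid_mx d n (M : 'M[int]_(d, n)) : (n <= d)%N ->
  exists L Q (e : 'rV[int]_n), [/\ L \in unitmx, Q \in unitmx
    & M = L *m pid_mx n *m diag_mx e *m Q].
Proof.
move=> le_nd; have [L unitL [Q unitQ [e _ ->]]] := int_Smith_normal_form M.
exists L, Q, (\row_j e`_j); split=> //.
rewrite -[L *m pid_mx n *m _]mulmxA; congr (_ *m _ *m _).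
apply/matrixP => i j; rewrite mul_mx_diag !mxE.
have [->|] := eqVneq (i : nat) j; last by rewrite mulr0n mul0r.
by rewrite ltn_ord mul1r mulr1n.
Qed.

Definition lattice_index n (H : 'M[int]_n) k :=
  exists reps : 'I_k -> 'cV[int]_n,
    (forall i j z, reps i - reps j = H *m z -> i = j) /\
    (forall v, exists i z, v - reps i = H *m z).

Lemma lattice_index_diag n (e : 'rV[int]_n) : (forall i, e 0 i != 0) ->
  lattice_index (diag_mx e) (\prod_i absz (e 0 i)%R).
Proof.
move=> e_neq0; pose T := {dffun forall i : 'I_n, 'I_(absz (e 0 i)%R)}.
have <- : #|T| = (\prod_i absz (e 0 i)%R)%N.
  rewrite card_dep_ffun foldrE big_map big_enum /=.
  by apply: eq_bigr => i _; rewrite card_ord.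
pose reps (t : T) : 'cV[int]_n := \col_i (t i : nat)%:Z.
exists (reps \o enum_val); split=> [i j z /colP eq_reps|v].
  apply: enum_val_inj; apply/ffunP => l; apply/val_inj/eqP.
  have : ((e 0 l)%R %| (enum_val i l : nat)%:Z - (enum_val j l : nat)%:Z)%Z.
    by have := eq_reps l; rewrite mul_diag_mx !mxE => ->; rewrite dvdz_mulr.
  rewrite -eqz_mod_dvd -modz_abs -[X in _ == X]modz_abs.
  by rewrite !modz_nat !modn_small ?ltn_ord.
have lt_mod i : (absz ((v i 0)%R %% (e 0 i)%R)%Z < absz (e 0 i)%R)%N.
  by rewrite -ltz_nat gez0_abs ?modz_ge0 // ltz_mod.
exists (enum_rank ([ffun i => Ordinal (lt_mod i)] : T)).
exists (\col_i ((v i 0)%R %/ (e 0 i)%R)%Z).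
apply/colP => i; rewrite mul_diag_mx /= enum_rankK !mxE ffunE /=.
by rewrite gez0_abs ?modz_ge0 // {1}(divz_eq (v i 0) (e 0 i)) addrK mulrC.
Qed.

Lemma lattice_index_det n (H : 'M[int]_n) :
  \det H != 0 -> lattice_index H `|\det H|.
Proof.
move=> nzH; have [L [Q [e [unitL unitQ EH]]]] := Smith_pid_mx H (leqnn n).
rewrite pid_mx_1 mulmx1 in EH.
have -> : `|\det H|%N = (\prod_i absz (e 0 i)%R)%N.
  rewrite EH !det_mulmx !abszM det_diag absz_prod.
  move: unitL unitQ; rewrite !unitmx_absz_det => /eqP-> /eqP->.
  by rewrite mul1n muln1.
have [|reps [reps_inj reps_surj]] := @lattice_index_diag _ e.
  move: nzH; rewrite EH !det_mulmx det_diag !mulf_eq0 !negb_or.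
  by case/andP=> /andP[_ /prodf_neq0 nz] _ i; apply: nz.
exists (fun i => L *m reps i); rewrite EH; split=> [i j z|v].
  rewrite -mulmxBr -!mulmxA => /(can_inj (mulKmx unitL)); exact: reps_inj.
have [i [z Ez]] := reps_surj (invmx L *m v).
exists i, (invmx Q *m z).
by rewrite -!mulmxA mulKVmx // -Ez mulmxBr mulKVmx.
Qed.

Section Multiplicity.
Variables (d N : nat).
Implicit Types (X : 'M[int]_(d, N)) (S : {set 'I_N}) (v w : 'cV[int]_d).

Lemma in_latticeB X S v w :
  in_lattice X S v -> in_lattice X S w -> in_lattice X S (v - w).
Proof.
move=> [a ->] [b ->]; exists (fun e => a e - b e).
by rewrite -sumrB; apply: eq_bigr => e _; rewrite scalerBl.
Qed.

Lemma mult_leq X S k k' : mult X S k -> mult X S k' -> (k <= k')%N.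
Proof.
move=> [p [satp injp _]] [q [_ _ surjq]].
have [h hP] := fin_all_exists (fun i => surjq _ (satp i)).
rewrite -(card_ord k) -(card_ord k'); apply: (leq_card h) => i j Eh.
apply: injp; have := in_latticeB (hP i) (hP j).
by rewrite Eh opprB addrA subrK.
Qed.

Lemma mult_unique X S k k' : mult X S k -> mult X S k' -> k = k'.
Proof. by move=> mk mk'; apply/eqP; rewrite eqn_leq !(@mult_leq X S). Qed.

Section Indexed.
Variables (n : nat) (f : 'I_n -> 'I_N).
Hypothesis injf : injective f.

Lemma in_lattice_imset X v :
  in_lattice X (f @: setT) v <-> exists z, v = colsub f X *m z.
Proof.
have sumE (c : 'I_N -> int) :
    \sum_(e in f @: setT) c e *: col e X = colsub f X *m \col_l c (f l).
  apply/colP => i; rewrite big_imset; last by move=> ? ? _ _; apply: injf.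
  rewrite summxE mxE; under eq_bigl do rewrite inE.
  by apply: eq_bigr => l _; rewrite !mxE mulrC.
split=> [[c ->]|[z ->]]; first by exists (\col_l c (f l)).
exists (fun e => \sum_(l | f l == e) z l 0); rewrite sumE; congr (_ *m _).
apply/colP => l; rewrite mxE (big_pred1 l) // => l'.
by rewrite (inj_eq injf).
Qed.

Lemma colsR_imset X : (colsR X (f @: setT) :=: map_mx intR (colsub f X)^T)%MS.
Proof.
apply/eqmxP/andP; split; apply/row_subP => i.
  have [/imsetP[l _ ->]|off] := boolP (i \in f @: setT).
    by apply: (eq_row_sub l); apply/rowP => j; rewrite !mxE imset_f.
  rewrite (_ : row i _ = 0) ?sub0mx //.
  by apply/rowP => j; rewrite !mxE (negbTE off).
by apply: (eq_row_sub (f i)); apply/rowP => j; rewrite !mxE imset_f.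
Qed.

Lemma arank_imset X :
  arank X (f @: setT) = \rank (map_mx intR (colsub f X)).
Proof. by rewrite /arank colsR_imset -map_trmx mxrank_tr. Qed.

(* The integral left inverse [P'] makes the lattice spanned by the columns of
   [P] saturated. *)
Lemma in_saturation_imset X (P : 'M[int]_(d, n)) P' H v :
  P' *m P = 1%:M -> \det H != 0 -> colsub f X = P *m H ->
  in_saturation X (f @: setT) v <-> exists z, v = P *m z.
Proof.
move=> P'P nzH EX; rewrite /in_saturation colsR_imset EX -!map_trmx !map_mxM.
rewrite trmx_mul; split=> [/submxP[w /(congr1 trmx)]|[z ->]].
  rewrite !trmx_mul !trmxK => Ev.
  exists (P' *m v); apply: map_intR_inj; rewrite !map_mxM Ev.
  by rewrite -!mulmxA (mulmxA (map_mx intR P')) -map_mxM P'P map_mx1 mul1mx.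
rewrite map_mxM trmx_mul mulmx_sub // (eqmxMfull _ _) //.
by rewrite row_full_unit unitmx_tr map_intR_unit.
Qed.

Lemma mult_saturated_factor X (P : 'M[int]_(d, n)) P' H :
  P' *m P = 1%:M -> \det H != 0 -> colsub f X = P *m H ->
  mult X (f @: setT) `|\det H|.
Proof.
move=> P'P nzH EX; have [reps [reps_inj reps_surj]] := lattice_index_det nzH.
exists (fun i => P *m reps i); split=> [i|i j|v].
- by apply/(in_saturation_imset _ P'P nzH EX); exists (reps i).
- rewrite -mulmxBr => /in_lattice_imset[z]; rewrite EX => /(congr1 (mulmx P')).
  by rewrite !mulmxA P'P !mul1mx; apply: reps_inj.
- case/(in_saturation_imset _ P'P nzH EX)=> w ->.
  have [i [z Ez]] := reps_surj w; exists i; apply/in_lattice_imset; exists z.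
  by rewrite EX -mulmxBr Ez mulmxA.
Qed.

End Indexed.

Lemma arank_imset_full X (f : 'I_d -> 'I_N) :
  (arank X (f @: setT) == d) = (\det (colsub f X) != 0).
Proof.
rewrite arank_imset -[_ == d]/(row_full _).
by rewrite row_full_unit map_intR_unit.
Qed.

Lemma mult_det X (f : 'I_d -> 'I_N) : injective f -> \det (colsub f X) != 0 ->
  mult X (f @: setT) `|\det (colsub f X)|.
Proof.
move=> injf nzdet.
by apply: (mult_saturated_factor injf (mul1mx 1%:M)); rewrite ?mul1mx.
Qed.

Lemma mult_set1_dvd X e k i :
  col e X != 0 -> mult X [set e] k -> (k %| X i e)%Z.
Proof.
move=> nzXe mk; pose f (l : 'I_1) := e.
have injf : injective f by move=> l l' _; rewrite !ord1.
have fE : f @: setT = [set e].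
  by apply/setP => x; rewrite inE; apply/imsetP/eqP => [[]|->] //; exists 0.
have d_gt0 : (0 < d)%N := leq_ltn_trans (leq0n i) (ltn_ord i).
have [L [Q [h [unitL _]]]] := Smith_pid_mx (colsub f X) d_gt0.
set P := L *m _; rewrite -mulmxA; set H := diag_mx h *m Q => EX.
have P'P : pid_mx 1 *m invmx L *m P = 1%:M.
  by rewrite mulmxA mulmxKV // pid_mx_id // pid_mx_1.
have XE j : X j e = P j 0 * \det H.
  by have /matrixP/(_ j 0) := EX; rewrite [LHS]mxE [RHS]mxE big_ord1 det_mx11.
have nzH : \det H != 0.
  apply: contraNneq nzXe => H0; apply/eqP/colP => j.
  by rewrite !mxE XE H0 mulr0.
have := mult_saturated_factor injf P'P nzH EX.
rewrite fE => /(mult_unique mk) ->.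
by rewrite XE dvdzE abszM dvdn_mull.
Qed.

Lemma same_arith_sqr_minors X X' :
  same_arith_matroid X X' -> same_sqr_minors X X'.
Proof.
move=> same f.
suff eq_abs : `|\det (colsub f X)|%N = `|\det (colsub f X')|%N.
  by apply/eqP; rewrite eqf_sqr -eqr_norm2 -!abszE eq_abs.
have [/injectiveP injf|/injectivePn[i [j ne_ij eq_f]]] := boolP (injectiveb f).
  have [Erk Emult] := same (f @: setT).
  have := arank_imset_full X f; rewrite Erk arank_imset_full.
  have [->|nz'] := eqVneq; first by move=> /esym/negbFE/eqP->.
  move=> /esym nz; apply: mult_unique (mult_det injf nz').
  by apply/Emult/mult_det.
have det0 (Y : 'M[int]_(d, N)) : \det (colsub f Y) = 0.
  rewrite -det_tr; apply: (determinant_alternate ne_ij) => l.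
  by rewrite !mxE eq_f.
by rewrite !det0.
Qed.

Lemma multiplicative_basis_factor X (f : 'I_d -> 'I_N) (k : 'I_d -> nat) :
  injective f -> \det (colsub f X) != 0 ->
  (forall l, mult X [set f l] (k l)) -> mult X (f @: setT) (\prod_l k l) ->
  exists2 P : 'M[int]_d, P \in unitmx &
    colsub f X = P *m diag_mx (\row_l (k l)%:Z).
Proof.
move=> injf nzdet mk mB.
have col_neq0 l : col (f l) X != 0.
  apply: contraNneq nzdet => /colP Xl0; rewrite (expand_det_col _ l) big1 //.
  by move=> i _; have := Xl0 i; rewrite !mxE => ->; rewrite mul0r.
pose P : 'M[int]_d := \matrix_(i, l) (X i (f l) %/ (k l)%:Z)%Z.
have EX : colsub f X = P *m diag_mx (\row_l (k l)%:Z).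
  apply/matrixP => i l; rewrite mul_mx_diag !mxE divzK //.
  exact: mult_set1_dvd (col_neq0 l) (mk l).
exists P => //; have := mult_unique (mult_det injf nzdet) mB.
have detE : `|\det (colsub f X)|%N = (`|\det P| * \prod_l k l)%N.
  rewrite EX det_mulmx abszM det_diag absz_prod.
  by congr (_ * _)%N; apply: eq_bigr => l _; rewrite mxE.
have : (0 < `|\det (colsub f X)|)%N by rewrite absz_gt0.
rewrite detE muln_gt0 => /andP[_ prod_gt0].
by rewrite unitmx_absz_det -[RHS]mul1n => /eqP; rewrite eqn_pmul2r.
Qed.

Lemma weakly_multiplicative_indexed X :
  \rank (map_mx intR X) = d -> weakly_multiplicative X ->
  exists (f : 'I_d -> 'I_N) (k : 'I_d -> nat),
    [/\ injective f, \det (colsub f X) != 0, forall l, mult X [set f l] (k l)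
      & mult X (f @: setT) (\prod_l k l)].
Proof.
move=> rkX [B [[rkB rkT] [mB [k [mBP kP EmB]]]]].
have rkTd : arank X setT = d.
  by rewrite -[setT]imset_id arank_imset mxsub_eq_id.
have cardB : #|B| = d by rewrite -rkB rkT.
pose f l : 'I_N := enum_val (cast_ord (esym cardB) l).
have injf : injective f by move=> l l' /enum_val_inj/cast_ord_inj.
have fB : f @: setT = B.
  apply/eqP; rewrite eqEcard card_imset // cardsT card_ord cardB leqnn andbT.
  by apply/subsetP => _ /imsetP[l _ ->]; apply: enum_valP.
exists f, (k \o f); split=> // [|l|].
- by rewrite -arank_imset_full fB rkT rkTd.
- by apply: kP; apply: enum_valP.
- suff <- : mB = (\prod_l (k \o f) l)%N by rewrite fB.
  rewrite EmB -fB big_imset /=; last by move=> ? ? _ _; apply: injf.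
  by under eq_bigl do rewrite inE.
Qed.

End Multiplicity.

Unset Implicit Arguments.

Theorem theorem1p1 (d N : nat) (X X' : 'M[int]_(d, N)) :
  (0 < d)%N -> (d <= N)%N ->
  \rank (map_mx intR X) = d -> \rank (map_mx intR X') = d ->
  same_arith_matroid X X' ->
  weakly_multiplicative X ->
  exists (T : 'M[int]_d) (eps : 'rV[int]_N),
    [/\ T \in unitmx,
        (forall i, eps 0 i = 1 \/ eps 0 i = -1)
      & X' = T *m X *m diag_mx eps].
Proof.
move=> _ _ rkX _ same /(weakly_multiplicative_indexed rkX).
case=> f [k [injf nzdet mult_k mult_prod]].
have minE := same_arith_sqr_minors same.
have nzdet' : \det (colsub f X') != 0 by rewrite -sqrf_eq0 -minE sqrf_eq0.
have [P unitP EX] := multiplicative_basis_factor injf nzdet mult_k mult_prod.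
have [P' unitP' EX'] : exists2 P' : 'M[int]_d, P' \in unitmx &
    colsub f X' = P' *m diag_mx (\row_l (k l)%:Z).
  by apply: multiplicative_basis_factor => // [l|]; apply/(same _).2.
have [T [eps [unitT eps_sign EX'T]]] :=
  unimodular_sign_equiv unitP unitP' nzdet EX EX' minE.
exists T, eps; split=> // i; apply/pred2P.
by rewrite /= -sqrf_eq1 eps_sign.
Qed.
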